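(* Let $X$ be a complex Banach space, let $T \in L(X)$ and let $\Phi=(\Phi_1,\Phi_2)$ be a spectral partitioning function for $T$. If $\Psi=(\Psi_1,\Psi_2)$ is a spectral valued function such that $\Psi << \Phi$, then $\Psi$ is a spectral a-partitioning function for $T$ if and only if $(\Phi_1(T) \setminus \Psi_1(T)) \bigsqcup (\Phi_2(T) \setminus \Psi_2(T))= \sigma(T)\setminus \sigma_a(T)$.
   Context: $L(X)$ is the Banach algebra of bounded linear operators on $X$; $\sigma(T)$ is the spectrum and $\sigma_a(T)$ the approximate point spectrum of $T$; $\mathcal{P}(\mathbb{C})$ is the set of all subsets of $\mathbb{C}$. The symbol $\bigsqcup$ denotes disjoint union: $A = B \bigsqcup C$ means $A = B\cup C$ and $B\cap C=\emptyset$. A spectral valued function is a function $\Phi=(\Phi_1,\Phi_2): L(X)\to \mathcal{P}(\mathbb{C})\times\mathcal{P}(\mathbb{C})$ such that for every $S\in L(X)$, $\Phi_1(S)\subset\sigma(S)$ and $\Phi_2(S)\subset\sigma(S)$. A spectral valued function $\Phi$ is a spectral partitioning function for $T\in L(X)$ if $\sigma(T)=\Phi_1(T)\bigsqcup\Phi_2(T)$, and a spectral a-partitioning function for $T$ if $\sigma_a(T)=\Phi_1(T)\bigsqcup\Phi_2(T)$. For spectral valued functions $\Psi,\Phi$, write $\Psi<<\Phi$ if for all $S\in L(X)$, $\Psi_1(S)\subset\Phi_1(S)$ and $\Psi_2(S)\subset\Phi_2(S)$. *)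

(* Defs.v *)
From HB Require Import structures.
From mathcomp Require Export all_boot all_order all_algebra.
From mathcomp Require Export complex mathcomp_extra.
From mathcomp Require Export boolp classical_sets reals topology normedtype.

Set Implicit Arguments.
Unset Strict Implicit.
Unset Printing Implicit Defensive.

Import Order.TTheory GRing.Theory Num.Theory.

Local Open Scope classical_set_scope.
Local Open Scope ring_scope.

(* Norms over R[i] take nonnegative values in R[i], ordered by: x <= y iff
   y - x is real and nonnegative. Hence M is real as soon as X <> 0. *)
Definition op_bounded (R : realType) (X : normedModType R[i]) (A : X -> X) :=
  exists M : R[i], forall x, `|A x| <= M * `|x|.

Record bounded_operator (R : realType) (X : normedModType R[i]) := BoundedOperator {
  op_fun :> {linear X -> X};
  op_boundedP : op_bounded op_fun }.

Section SubScalar.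
Variables (R : realType) (X : normedModType R[i]).
Variables (T : bounded_operator X) (l : R[i]).

Definition sub_scalar_fun (x : X) : X := T x - l *: x.

Lemma sub_scalar_is_linear : linear sub_scalar_fun.
Proof.
move=> a x y; rewrite /sub_scalar_fun linearP scalerDr scalerBr !scalerA.
by rewrite (mulrC l a) opprD addrACA.
Qed.

HB.instance Definition _ :=
  GRing.isLinear.Build R[i] X X *:%R sub_scalar_fun sub_scalar_is_linear.

Lemma sub_scalar_bounded : op_bounded sub_scalar_fun.
Proof.
have [M TM] := op_boundedP T; exists (M + `|l|) => x.
rewrite mulrDl (le_trans (ler_normB _ _))// normrZ.
by rewrite lerD2r.
Qed.

Definition sub_scalar : bounded_operator X :=
  BoundedOperator sub_scalar_bounded.

End SubScalar.

Definition op_invertible (R : realType) (X : normedModType R[i])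
    (A : bounded_operator X) :=
  exists B : bounded_operator X, cancel A B /\ cancel B A.

Definition spectrum (R : realType) (X : normedModType R[i])
    (T : bounded_operator X) : set R[i] :=
  [set l | ~ op_invertible (sub_scalar T l)].

Definition approx_point_spectrum (R : realType) (X : normedModType R[i])
    (T : bounded_operator X) : set R[i] :=
  [set l | exists x : nat -> X, (forall n, `|x n| = 1) /\
    (sub_scalar T l (x n) @[n --> \oo] --> (0 : X))].

Definition disjoint_union (T : Type) (A B C : set T) :=
  A = B `|` C /\ B `&` C = set0.

Definition spectral_valued (R : realType) (X : normedModType R[i])
    (Phi : bounded_operator X -> set R[i] * set R[i]) :=
  forall S, (Phi S).1 `<=` spectrum S /\ (Phi S).2 `<=` spectrum S.

Definition spectral_partitioning (R : realType) (X : normedModType R[i])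
    (Phi : bounded_operator X -> set R[i] * set R[i])
    (T : bounded_operator X) :=
  spectral_valued Phi /\ disjoint_union (spectrum T) (Phi T).1 (Phi T).2.

Definition spectral_a_partitioning (R : realType) (X : normedModType R[i])
    (Phi : bounded_operator X -> set R[i] * set R[i])
    (T : bounded_operator X) :=
  spectral_valued Phi /\
  disjoint_union (approx_point_spectrum T) (Phi T).1 (Phi T).2.

Definition spectral_le (R : realType) (X : normedModType R[i])
    (Psi Phi : bounded_operator X -> set R[i] * set R[i]) :=
  forall S, (Psi S).1 `<=` (Phi S).1 /\ (Psi S).2 `<=` (Phi S).2.

(* Main.v *)
Require Import Defs.

Set Implicit Arguments.
Unset Strict Implicit.
Unset Printing Implicit Defensive.

Import Order.TTheory GRing.Theory Num.Theory.

Local Open Scope classical_set_scope.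
Local Open Scope ring_scope.

(** Since [Phi] splits the spectrum into disjoint parts and [Psi] takes a subset of each,
    complementing in [spectrum T] turns the union of the [Psi] parts into the union of the
    differences. As the approximate point spectrum lies in the spectrum
    ([approx_point_spectrum_sub]), the equivalence is pure set algebra ([disjoint_union_setD]). *)

(* A bounded inverse makes [T - l] bounded below, so it cannot send unit
   vectors to a null sequence. *)
Lemma approx_point_spectrum_sub (R : realType) (X : normedModType R[i])
    (T : bounded_operator X) : approx_point_spectrum T `<=` spectrum T.
Proof.
move=> l [x [x1 Ax0]] [B [AB _]].
have [M BM] := op_boundedP B.
(* The bound [M] is only a complex number; [|M| + 1] is positive, hence invertible, whatever [M]
   is. *)
have M1_gt0 : 0 < `|M| + 1 by rewrite ltr_wpDl.
have /cvgr0Pnorm_lt/(_ (`|M| + 1)^-1) := Ax0.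
rewrite invr_gt0 => /(_ M1_gt0) [n _ /(_ n (leqnn n))] /= Axn.
have := BM (sub_scalar T l (x n)); rewrite AB x1 => ge1.
(* A number above 1 is its own norm, which lets [|M|] replace [M] in [ge1]. *)
have /ger0_norm := le_trans ler01 ge1; rewrite normrM normr_id => normM.
rewrite -normM in ge1; rewrite -[_^-1]mul1r ltr_pdivlMr // in Axn.
suff : (1 : R[i]) < 1 by rewrite ltxx.
apply: le_lt_trans ge1 (le_lt_trans _ Axn).
by rewrite mulrC ler_wpM2l // lerDl.
Qed.

(* Both disjointness conditions are inherited from [P1 `&` P2 = set0]. *)
Lemma disjoint_union_setD (U : Type) (S A P1 P2 Q1 Q2 : set U) :
  A `<=` S -> disjoint_union S P1 P2 -> Q1 `<=` P1 -> Q2 `<=` P2 ->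
  disjoint_union A Q1 Q2 <-> disjoint_union (S `\` A) (P1 `\` Q1) (P2 `\` Q2).
Proof.
move=> AS [SP P0] QP1 QP2.
have P12 z : P1 z -> P2 z -> False.
  by move=> p1 p2; have : (P1 `&` P2) z by []; rewrite P0.
have SPz z : S z <-> P1 z \/ P2 z by rewrite SP.
split=> -[E _]; split.
- rewrite E; apply/seteqP; split=> z /=;
    by move: (SPz z) (@P12 z) (QP1 z) (QP2 z); tauto.
- by rewrite -subset0 => z [[p1 _] [p2 _]]; apply: P12 p1 p2.
(* [A] is recovered as the complement of [S \ A] in [S]; this uses [AS] and excluded middle. *)
- have Ez z : S z /\ ~ A z <-> P1 z /\ ~ Q1 z \/ P2 z /\ ~ Q2 z.
    by rewrite -[S z /\ _]/((S `\` A) z) E.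
  apply/seteqP; split=> z /=;
    move: (Ez z) (SPz z) (@P12 z) (QP1 z) (QP2 z) (AS z);
    by move: (EM (A z)) (EM (Q1 z)) (EM (Q2 z)); tauto.
- by rewrite -subset0 => z [/QP1 p1 /QP2 p2]; apply: P12 p1 p2.
Qed.

Theorem theorem4p8 (R : realType) (X : completeNormedModType R[i])
    (T : bounded_operator X)
    (Phi Psi : bounded_operator X -> set R[i] * set R[i]) :
  spectral_partitioning Phi T ->
  spectral_valued Psi ->
  spectral_le Psi Phi ->
  (spectral_a_partitioning Psi T <->
   disjoint_union (spectrum T `\` approx_point_spectrum T)
     ((Phi T).1 `\` (Psi T).1) ((Phi T).2 `\` (Psi T).2)).
Proof.
move=> [_ partPhi] valPsi /(_ T) [le1 le2].
have E := disjoint_union_setD (@approx_point_spectrum_sub _ _ T) partPhi le1 le2.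
by split=> [[_ /E]|/E].
Qed.
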